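(* Let $\mathcal{A}=\{\mathbf a_1,\dots,\mathbf a_n\}\subset\mathbb N^m$, let $A\in\mathcal M_{m\times n}(\mathbb N)$ be the matrix with columns $\mathbf a_1,\dots,\mathbf a_n$, let $\mathcal L(\mathcal A)=\operatorname{Ker}_{\mathbb Z}(A)\subset\mathbb Z^n$, and assume $\mathcal L(\mathcal A)\cap\mathbb N^n=\{\mathbf 0\}$. Let $\mathbf u\in\mathcal L(\mathcal A)$ be a nonzero vector. Then: (i) if $\mathbf u$ has a proper conformal decomposition then $\mathbf u$ has a proper strongly semiconformal decomposition; (ii) if $\mathbf u$ has a proper strongly semiconformal decomposition then $\mathbf u$ has a proper semiconformal decomposition.
   Context: $\mathbb N$ contains $0$. For $\mathbf u\in\mathbb Z^n$, $\mathbf u^+,\mathbf u^-\in\mathbb N^n$ are the unique vectors with disjoint supports such that $\mathbf u=\mathbf u^+-\mathbf u^-$. For vectors, $\mathbf a\ge\mathbf b$ is the componentwise order and $\mathbf a>\mathbf b$ means $\mathbf a\ge\mathbf b$ and $\mathbf a\ne\mathbf b$. All vectors below are in $\mathcal L(\mathcal A)$. Conformal decomposition: $\mathbf u=\mathbf v+_c\mathbf w$ means $\mathbf u=\mathbf v+\mathbf w$, $\mathbf u^+=\mathbf v^++\mathbf w^+$ and $\mathbf u^-=\mathbf v^-+\mathbf w^-$. Semiconformal decomposition: $\mathbf u=\mathbf v+_{sc}\mathbf w$ means $\mathbf u=\mathbf v+\mathbf w$ and for every coordinate $i$: $\mathbf v(i)>0$ implies $\mathbf w(i)\ge0$, and $\mathbf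 w(i)<0$ implies $\mathbf v(i)\le0$. Strongly semiconformal decomposition: for $l\ge 2$, $\mathbf u=_{ssc}\mathbf u_1+\cdots+\mathbf u_l$ means $\mathbf u=\mathbf u_1+\cdots+\mathbf u_l$, $\mathbf u^+>\mathbf u_1^+$, and $\mathbf u^+>\big(\sum_{j=1}^{i-1}\mathbf u_j\big)+\mathbf u_i^+$ for all $i=2,\dots,l$. Any of these decompositions is proper if all of its summands are nonzero. *)

(* Defs.v *)
From HB Require Import structures.
From mathcomp Require Import all_boot all_order all_algebra.
Set Implicit Arguments.
Unset Strict Implicit.
Unset Printing Implicit Defensive.
Import Order.TTheory GRing.Theory Num.Theory.
Local Open Scope ring_scope.

(* Vectors of Z^n are column vectors over int; vectors of N^n are those whose
   coordinates are all nonnegative. *)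

Definition nonneg_vec (n : nat) (v : 'cV[int]_n) : Prop :=
  forall i, 0 <= v i 0.

Definition lattice (m n : nat) (A : 'M[nat]_(m, n)) (u : 'cV[int]_n) : Prop :=
  map_mx Posz A *m u = 0.

Definition pos_part (n : nat) (u : 'cV[int]_n) : 'cV[int]_n :=
  \col_i Num.max (u i 0) 0.

Definition neg_part (n : nat) (u : 'cV[int]_n) : 'cV[int]_n :=
  \col_i Num.max (- u i 0) 0.

(* pos_part u and neg_part u are the unique nonnegative vectors with disjoint
   supports whose difference is u. *)
Lemma pos_neg_partP (n : nat) (u p q : 'cV[int]_n) :
  [/\ nonneg_vec p, nonneg_vec q,
      (forall i, p i 0 = 0 \/ q i 0 = 0) & u = p - q]
  <-> p = pos_part u /\ q = neg_part u.
Proof.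
split=> [[p0 q0 dpq ->]|[-> ->]].
  split; apply/colP=> i; rewrite !mxE.
    case: (dpq i) => ->; last by rewrite subr0 max_l.
    by rewrite sub0r max_r // oppr_le0.
  case: (dpq i) => ->; first by rewrite sub0r opprK max_l.
  by rewrite subr0 max_r // oppr_le0.
split=> [i|i|i|]; rewrite ?mxE ?le_max ?lexx ?orbT //.
  by case: (leP (u i 0) 0) => ui; [left|right; rewrite max_r // oppr_le0 ltW].
apply/colP=> i; rewrite !mxE; case: (leP (u i 0) 0) => ui.
  by rewrite max_l ?oppr_ge0 // sub0r opprK.
by rewrite max_r ?subr0 // oppr_le0 ltW.
Qed.

Definition vec_le (n : nat) (a b : 'cV[int]_n) : Prop :=
  forall i, a i 0 <= b i 0.

Definition vec_lt (n : nat) (a b : 'cV[int]_n) : Prop :=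
  vec_le a b /\ a <> b.

Definition conformal (n : nat) (u v w : 'cV[int]_n) : Prop :=
  [/\ u = v + w, pos_part u = pos_part v + pos_part w
    & neg_part u = neg_part v + neg_part w].

Definition semiconformal (n : nat) (u v w : 'cV[int]_n) : Prop :=
  u = v + w /\
  forall i, (0 < v i 0 -> 0 <= w i 0) /\ (w i 0 < 0 -> v i 0 <= 0).

(* The summands u_1, ..., u_l are indexed from 0: us i stands for u_(i+1). *)
Definition strongly_semiconformal (n l : nat) (u : 'cV[int]_n)
    (us : 'I_l -> 'cV[int]_n) : Prop :=
  [/\ (2 <= l)%N, u = \sum_(j < l) us j,
      forall i : 'I_l, i = 0%N :> nat -> vec_lt (pos_part (us i)) (pos_part u)
    & forall i : 'I_l, (0 < i)%N ->
        vec_lt (\sum_(j < l | (j < i)%N) us j + pos_part (us i)) (pos_part u)].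

Definition has_proper_conformal (m n : nat) (A : 'M[nat]_(m, n))
    (u : 'cV[int]_n) : Prop :=
  exists v w : 'cV[int]_n,
    [/\ lattice A v, lattice A w, v <> 0, w <> 0 & conformal u v w].

Definition has_proper_semiconformal (m n : nat) (A : 'M[nat]_(m, n))
    (u : 'cV[int]_n) : Prop :=
  exists v w : 'cV[int]_n,
    [/\ lattice A v, lattice A w, v <> 0, w <> 0 & semiconformal u v w].

Definition has_proper_strongly_semiconformal (m n : nat) (A : 'M[nat]_(m, n))
    (u : 'cV[int]_n) : Prop :=
  exists (l : nat) (us : 'I_l -> 'cV[int]_n),
    [/\ forall i, lattice A (us i), forall i, us i <> 0
      & strongly_semiconformal u us].

(* Main.v *)
Require Import Defs.
From HB Require Import structures.
From mathcomp Require Import all_boot all_order all_algebra.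
Set Implicit Arguments.
Unset Strict Implicit.
Unset Printing Implicit Defensive.
Import Order.TTheory GRing.Theory Num.Theory.
Local Open Scope ring_scope.

(** A conformal decomposition [u = v + w] is itself a strongly semiconformal
    one of length two. Its two inequalities follow from
    [pos_part u = pos_part v + pos_part w] and [v <= pos_part v]. The first
    is an equality only if [pos_part w = 0], the second only if
    [neg_part v = 0]; then [- w], resp. [v], is a nonnegative vector of the
    lattice, so it vanishes, against properness.

    In the other direction, split off the first summand [v] of a strongly
    semiconformal decomposition: it satisfies [pos_part v < pos_part u]. The
    weak inequality makes [u = v + (u - v)] semiconformal
    ([semiconformal_sub]), and its strictness gives [u - v <> 0]. *)

Lemma latticeN (m n : nat) (A : 'M[nat]_(m, n)) (v : 'cV[int]_n) :
  lattice A v -> lattice A (- v).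
Proof. by rewrite /lattice mulmxN => ->; rewrite oppr0. Qed.

Lemma latticeB (m n : nat) (A : 'M[nat]_(m, n)) (v w : 'cV[int]_n) :
  lattice A v -> lattice A w -> lattice A (v - w).
Proof. by rewrite /lattice mulmxBr => -> ->; rewrite subr0. Qed.

Lemma pos_part_ge0 (n : nat) (v : 'cV[int]_n) : nonneg_vec (pos_part v).
Proof. by move=> i; rewrite mxE le_max lexx orbT. Qed.

Lemma le_pos_part (n : nat) (v : 'cV[int]_n) : vec_le v (pos_part v).
Proof. by move=> i; rewrite mxE le_max lexx. Qed.

Lemma pos_part0_oppr_ge0 (n : nat) (v : 'cV[int]_n) :
  pos_part v = 0 -> nonneg_vec (- v).
Proof.
by move=> v0 i; have := le_pos_part v i; rewrite v0 !mxE oppr_ge0.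
Qed.

Lemma pos_part_id_ge0 (n : nat) (v : 'cV[int]_n) :
  v = pos_part v -> nonneg_vec v.
Proof. by move=> ->; exact: pos_part_ge0. Qed.

(** At a coordinate where [v] is positive, the hypothesis forces [u] to be
    positive as well, so that both vectors agree there with their positive
    parts and [v <= u]. This is all that semiconformality asks for, its two
    implications being contrapositives of each other. *)
Lemma semiconformal_sub (n : nat) (u v : 'cV[int]_n) :
  vec_le (pos_part v) (pos_part u) -> semiconformal u v (u - v).
Proof.
move=> le_vu; have sub_ge0 i : 0 < v i 0 -> 0 <= (u - v) i 0.
  move=> vi_gt0; have := le_vu i; rewrite !mxE subr_ge0 (max_l (ltW vi_gt0)).
  by rewrite le_max [v i 0 <= 0]leNgt vi_gt0 orbF.
split=> [|i]; first by rewrite addrC subrK.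
by split=> [/sub_ge0 //|]; case: (leP (v i 0) 0) => // /sub_ge0; case: leP.
Qed.

(** Both weak inequalities hold in any conformal decomposition; strictness
    comes from the lattice having no nonzero nonnegative vector, applied to
    [- w] for the first inequality and to [v] for the second. *)
Lemma conformal_strongly_semiconformal (m n : nat) (A : 'M[nat]_(m, n))
    (u v w : 'cV[int]_n) :
  (forall x : 'cV[int]_n, lattice A x -> nonneg_vec x -> x = 0) ->
  lattice A v -> lattice A w -> v <> 0 -> w <> 0 -> conformal u v w ->
  strongly_semiconformal u (fun j : 'I_2 => if j == 0 then v else w).
Proof.
move=> pointed Av Aw v0 w0 [u_vw uP _].
split=> //; first by rewrite big_ord_recl big_ord1.
- move=> i i0; have -> : i = 0 by apply: val_inj.
  rewrite eqxx uP; split=> [k|vvw].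
    by rewrite [leRHS]mxE lerDl; exact: pos_part_ge0.
  have wP0 : pos_part w = 0 by apply: (addrI (pos_part v)); rewrite addr0.
  apply: w0; rewrite -[w]opprK (pointed (- w)) ?oppr0 //.
    exact: latticeN.
  exact: pos_part0_oppr_ge0.
- move=> i i_gt0; have -> : i = 1 by apply: val_inj; case: i i_gt0 => [[|[|]]].
  rewrite big_mkcond big_ord_recl big_ord1 /= addr0 uP.
  split=> [k|/addIr vv]; last by apply: v0; apply: pointed (pos_part_id_ge0 vv).
  by rewrite [leLHS]mxE [leRHS]mxE lerD2r; exact: le_pos_part.
Qed.

Theorem lemma1p2 (m n : nat) (A : 'M[nat]_(m, n))
    (hA : forall v : 'cV[int]_n, lattice A v /\ nonneg_vec v <-> v = 0)
    (u : 'cV[int]_n) (hu : lattice A u) (hu0 : u <> 0) :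
  (has_proper_conformal A u -> has_proper_strongly_semiconformal A u) /\
  (has_proper_strongly_semiconformal A u -> has_proper_semiconformal A u).
Proof.
split=> [[v [w [Av Aw v0 w0 c_uvw]]]|[l [us [Aus us0 [l2 _ lt_head _]]]]].
  exists 2%N, (fun j : 'I_2 => if j == 0 then v else w).
  split=> [j|j|]; [by case: ifP|by case: ifP|].
  apply: conformal_strongly_semiconformal Av Aw v0 w0 c_uvw => x Ax x_ge0.
  by apply/hA; split.
pose i0 := Ordinal (ltnW l2).
have [le_vu neq_vu] := lt_head i0 erefl.
exists (us i0), (u - us i0); split=> //; first exact: latticeB.
  by move=> /subr0_eq u_v; apply: neq_vu; rewrite -u_v.
exact: semiconformal_sub.
Qed.
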